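(* Let $p\ge 2$, $a>b>0$, $x=(a-b)/(a+b)$ and $A=(a+b)/2$. Then, all means being evaluated at $(a,b)$, $$\frac{4(1+x^p)\left(1+\frac{x^p}{p+1}\right)}{(x^p+2)^2}\le\frac{\tilde{T}_p}{A}\le 1+\frac{x^p}{1+p}$$ and $$\frac{4(1-x^p)\left(1-\frac{x^p}{1+p}\right)}{(2-x^p)^2}\le\frac{\tilde{L}_p}{A}\le 1-\frac{x^p}{1+p}.$$
   Context: For $p>1$ and $x\in(0,1)$ define $$\arctan_p(x)=\int_0^x(1+t^p)^{-1}\,dt,\quad \mathrm{arctanh}_p(x)=\int_0^x(1-t^p)^{-1}\,dt.$$ For $p\ge 2$ and $a>b>0$ define $$\tilde{T}_p(a,b)=\frac{a-b}{2\arctan_p\left(\frac{a-b}{a+b}\right)},\quad \tilde{L}_p(a,b)=\frac{a-b}{2\,\mathrm{arctanh}_p\left(\frac{a-b}{a+b}\right)}.$$ *)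

(* Defs.v *)
From HB Require Import structures.
From mathcomp Require Import all_boot all_order all_algebra.
From mathcomp Require Import all_classical all_reals all_analysis.

Set Implicit Arguments.
Unset Strict Implicit.
Unset Printing Implicit Defensive.

Import Order.TTheory GRing.Theory Num.Theory.
Import numFieldNormedType.Exports.

Local Open Scope classical_set_scope.
Local Open Scope ring_scope.

(* The functions below are total; they carry their mathematical meaning for
   1 < p and 0 < x < 1, where both integrands are continuous on [0, x]
   (note that 0 `^ p = 0 for p != 0). *)
Definition arctan_p (R : realType) (p x : R) : R :=
  \int[lebesgue_measure]_(t in `[0, x]) (1 + t `^ p)^-1.

Definition arctanh_p (R : realType) (p x : R) : R :=
  \int[lebesgue_measure]_(t in `[0, x]) (1 - t `^ p)^-1.

Definition T_p (R : realType) (p a b : R) : R :=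
  (a - b) / (2 * arctan_p p ((a - b) / (a + b))).

Definition L_p (R : realType) (p a b : R) : R :=
  (a - b) / (2 * arctanh_p p ((a - b) / (a + b))).

(* Main.v *)
Require Import Defs.
From HB Require Import structures.
From mathcomp Require Import all_boot all_order all_algebra.
From mathcomp Require Import all_classical all_reals all_analysis.
From mathcomp Require Import ring lra.

Import Order.TTheory GRing.Theory Num.Theory.
Import numFieldNormedType.Exports.

Local Open Scope ring_scope.

(** Write [s = x ^ p] and let [f t = 1 + c * t ^ p] on [[0, x]], with [c = 1]
    for [T_p] and [c = -1] for [L_p].  Since [(a - b) / 2 = A * x], both ratios
    in the theorem equal [x / J], where [J] is the integral of [1 / f] over
    [[0, x]]: they are harmonic means of [f].  The integral of [f] itself is
    elementary, so its arithmetic mean is [m = 1 + c * s / (p + 1)], and the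
    theorem compares the two means.

    - The upper bound is the inequality between harmonic and arithmetic means,
      obtained by integrating [1 / f >= 2 / m - f / m ^ 2], the tangent line of
      the inverse at [m] ([le_Rintegral_mul_inv]).
    - The lower bound is the reverse inequality of Kantorovich.  As [f] stays
      between [u = 1] and [v = 1 + c * s], the inverse lies below its
      chord, [1 / f <= (u + v - f) / (u * v)].  Integrating, and maximising
      [m * (u + v - m)] over [m], gives
      [4 * u * v * m * J <= (u + v) ^ 2 * x] ([Rintegral_mul_inv_le]).

    The two signs are handled together in [mean_1Dpow_bounds]. *)

(** * Continuity and integration of affine and inverse expressions *)

Lemma within_continuousV (R : realType) (D : set R) (f : R -> R) :
  (forall t, D t -> f t != 0) ->
  {within D, continuous f}%classic ->
  {within D, continuous (fun t => (f t)^-1)}%classic.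
Proof.
move=> f0 /subspace_continuousP cf; apply/subspace_continuousP => t Dt.
by apply: cvgV; [exact: f0|exact: cf].
Qed.

Lemma within_continuous_affine (R : realType) (D : set R) (k l : R)
    (f : R -> R) :
  {within D, continuous f}%classic ->
  {within D, continuous (fun t => k - l * f t)}%classic.
Proof.
move=> cf t; apply: cvgB; first exact: cvg_cst.
by apply: cvgM; [exact: cvg_cst|exact: cf].
Qed.

Lemma within_continuous_integrable_itv (R : realType) (a b : R) (f : R -> R) :
  {within `[a, b], continuous f}%classic ->
  lebesgue_measure.-integrable `[a, b]%classic (EFin \o f).
Proof.
move=> cf; apply: continuous_compact_integrable => //.
exact: segment_compact.
Qed.

Lemma Rintegral_affine (R : realType) (a b k l : R) (f : R -> R) :
  a <= b -> {within `[a, b], continuous f}%classic ->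
  \int[lebesgue_measure]_(t in `[a, b]) (k - l * f t) =
  k * (b - a) - l * \int[lebesgue_measure]_(t in `[a, b]) f t.
Proof.
move=> ab cf.
have lenE : fine (lebesgue_measure (`[a, b]%classic : set R)) = b - a.
  rewrite lebesgue_measure_itv /= lte_fin; case: ltP => // ba.
  by rewrite (le_anti (introT andP (conj ab ba))) subrr.
have ck : {within `[a, b], continuous (fun _ : R => k)}%classic.
  by move=> t; exact: cvg_cst.
have clf : {within `[a, b], continuous (fun t => l * f t)}%classic.
  by move=> t; apply: cvgM; [exact: cvg_cst|exact: cf].
rewrite RintegralB //; [|exact: within_continuous_integrable_itv..].
rewrite Rintegral_cst // RintegralZl //; first by congr (_ * _ - _).
exact: within_continuous_integrable_itv.
Qed.

(** * The inverse function between its tangent lines and its chords *)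

Lemma ge_tangent_inv (R : realFieldType) (m y : R) :
  0 < m -> 0 < y -> 2 / m - m^-2 * y <= y^-1.
Proof.
move=> m0 y0.
have -> : 2 / m - m^-2 * y = y^-1 - y * (y^-1 - m^-1) ^+ 2.
  by field; rewrite !gt_eqF.
by rewrite gerBl mulr_ge0 ?sqr_ge0 // ltW.
Qed.

Lemma gt0_between (R : realFieldType) (u v y : R) :
  0 < u -> 0 < v -> 0 <= (y - u) * (v - y) -> 0 < y.
Proof.
move=> u0 v0; apply: contraTT; rewrite -leNgt -ltNge => y0.
by rewrite nmulr_rlt0 ?subr_gt0 ?subr_lt0 ?(le_lt_trans y0).
Qed.

Lemma le_chord_inv (R : realFieldType) (u v y : R) :
  0 < u -> 0 < v -> 0 <= (y - u) * (v - y) ->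
  y^-1 <= (u + v) / (u * v) - (u * v)^-1 * y.
Proof.
move=> u0 v0 uv; have y0 := gt0_between _ _ _ _ u0 v0 uv.
rewrite -subr_ge0.
have -> : (u + v) / (u * v) - (u * v)^-1 * y - y^-1 =
    (y - u) * (v - y) / (u * v * y) by field; rewrite !gt_eqF.
by rewrite divr_ge0 // ltW // !mulr_gt0.
Qed.

(** * Integral of a function against that of its inverse *)

Section kantorovich.
Context {R : realType}.
Variables (a b u v : R) (f : R -> R).
Hypotheses (ab : a < b) (u0 : 0 < u) (v0 : 0 < v).
Hypothesis cf : {within `[a, b], continuous f}%classic.
(** Betweenness is written as a product because this leaves open which of [u]
    and [v] is the larger: increasing and decreasing [f] are treated alike. *)
Hypothesis fuv : forall t, a <= t <= b -> 0 <= (f t - u) * (v - f t).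

Let I := \int[lebesgue_measure]_(t in `[a, b]) f t.
Let J := \int[lebesgue_measure]_(t in `[a, b]) (f t)^-1.

Let f_gt0 t : a <= t <= b -> 0 < f t.
Proof. by move=> /fuv; exact: gt0_between. Qed.

Let intV : lebesgue_measure.-integrable `[a, b]%classic
  (EFin \o (fun t => (f t)^-1)).
Proof.
apply: within_continuous_integrable_itv; apply: within_continuousV => // t /=.
by rewrite in_itv/= => /f_gt0/gt_eqF->.
Qed.

Let le_affine_J k l : (forall t, a <= t <= b -> k - l * f t <= (f t)^-1) ->
  k * (b - a) - l * I <= J.
Proof.
move=> h; rewrite -(Rintegral_affine _ _ _ _ _ _ (ltW ab) cf).
apply: le_Rintegral => //.
exact/within_continuous_integrable_itv/within_continuous_affine.
Qed.

Let ge_affine_J k l : (forall t, a <= t <= b -> (f t)^-1 <= k - l * f t) ->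
  J <= k * (b - a) - l * I.
Proof.
move=> h; rewrite -(Rintegral_affine _ _ _ _ _ _ (ltW ab) cf).
apply: le_Rintegral => //.
exact/within_continuous_integrable_itv/within_continuous_affine.
Qed.

Let I_gt0 : 0 < I.
Proof.
have uv0 : 0 < u + v by exact: addr_gt0.
(* Betweenness gives [(u + v) * f >= u * v + f ^ 2 >= u * v], hence the lower
   bound [k] on [f], which does not require comparing [u] with [v]. *)
pose k := u * v / (u + v).
have k0 : 0 < k by rewrite divr_gt0 ?mulr_gt0.
have : 0 <= - k * (b - a) - (-1) * I.
  rewrite -(Rintegral_affine _ _ _ _ _ _ (ltW ab) cf); apply: Rintegral_ge0.
  move=> t /=; rewrite in_itv/= => /fuv ft.
  rewrite mulN1r opprK addrC subr_ge0 ler_pdivrMr //.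
  have := sqr_ge0 (f t); nra.
rewrite mulN1r opprK addrC mulNr subr_ge0; apply: lt_le_trans.
by rewrite mulr_gt0 ?subr_gt0.
Qed.

(** The constant [m] in the tangent bound is the mean of [f], the choice that
    makes the integrated bound optimal. *)
Lemma le_Rintegral_mul_inv : (b - a) ^+ 2 <= I * J.
Proof.
have ba0 : 0 < b - a by rewrite subr_gt0.
pose m := I / (b - a); have m0 : 0 < m by rewrite divr_gt0 ?I_gt0.
have H : 2 / m * (b - a) - m^-2 * I <= J.
  by apply: le_affine_J => t /f_gt0; exact: ge_tangent_inv.
rewrite mulrC -ler_pdivrMr ?I_gt0//; apply: le_trans H.
by rewrite le_eqVlt; apply/orP; left; apply/eqP; rewrite /m; field;
   rewrite !gt_eqF ?I_gt0.
Qed.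

(** Kantorovich's inequality: integrating the chord bound gives
    [u * v * J <= (u + v) * (b - a) - I], and a product of two numbers is at
    most the square of half their sum. *)
Lemma Rintegral_mul_inv_le :
  4 * (u * v) * (I * J) <= ((u + v) * (b - a)) ^+ 2.
Proof.
have uv0 : 0 < u * v by exact: mulr_gt0.
have : J <= (u + v) / (u * v) * (b - a) - (u * v)^-1 * I.
  by apply: ge_affine_J => t /fuv; exact: le_chord_inv.
have -> : (u + v) / (u * v) * (b - a) - (u * v)^-1 * I =
    ((u + v) * (b - a) - I) / (u * v) by field; rewrite !gt_eqF.
rewrite ler_pdivlMr // => /(ler_wpM2l (ltW I_gt0)) H.
have := sqr_ge0 ((u + v) * (b - a) - I *+ 2); nra.
Qed.

End kantorovich.

(** * The functions 1 + c t^p *)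

Section powR_itv.
Context {R : realType}.
Variables (p x : R).
Hypotheses (p0 : 0 < p) (x0 : 0 < x).

Lemma powR_derivable_oo_LRcontinuous (q : R) : 0 < q ->
  derivable_oo_LRcontinuous (fun t => t `^ q) 0 x.
Proof.
move=> q0; split.
- move=> t; rewrite in_itv/= => /andP[t0 _].
  by apply: derivable_powR; rewrite in_itv/= t0.
- by rewrite powR0 ?gt_eqF//; exact: powR_cvg0.
- apply: cvg_at_left_filter.
  have d : derivable (fun t : R => t `^ q) x 1.
    by apply: derivable_powR; rewrite in_itv/= x0.
  have /derivable1_diffP/differentiable_continuous := d.
  by apply.
Qed.

Lemma within_continuous_powR :
  {within `[0, x], continuous (fun t => t `^ p)}%classic.
Proof.
exact/derivable_oo_LRcontinuous_within/powR_derivable_oo_LRcontinuous.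
Qed.

Lemma Rintegral_powR :
  \int[lebesgue_measure]_(t in `[0, x]) t `^ p = x * x `^ p / (p + 1).
Proof.
have q0 : 0 < p + 1 by rewrite addr_gt0.
have dF (t : R) : 0 < t ->
    is_derive t 1 (fun t : R => (p + 1)^-1 * t `^ (p + 1)) (t `^ p).
  move=> t0; have d := is_derive1_powR (p + 1) t0.
  apply: is_derive_eq.
  by rewrite /GRing.scale /= mulrA mulVf ?gt_eqF// mul1r addrK.
rewrite /Rintegral.
rewrite (@continuous_FTC2 _ _ (fun t : R => (p + 1)^-1 * t `^ (p + 1))) //=.
- rewrite powR0 ?gt_eqF// mulr0 subr0 powRD; last by rewrite gt_eqF ?implybT.
  by rewrite powRr1 ?ltW//; field; rewrite gt_eqF.
- exact: within_continuous_powR.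
- have [_ F1 F2] := powR_derivable_oo_LRcontinuous _ q0; split.
  + move=> t; rewrite in_itv/= => /andP[t0 _].
    by have [] := dF _ t0.
  + by apply: cvgM; [exact: cvg_cst|].
  + by apply: cvgM; [exact: cvg_cst|].
- move=> t; rewrite in_itv/= => /andP[t0 _].
  by rewrite derive1E; have [] := dF _ t0.
Qed.

(** The two bounds on [I * J] for [f t = 1 + c * t ^ p], [u = 1] and
    [v = 1 + c * s].  They apply to either sign of [c], because
    [(f - u) * (v - f) = c ^ 2 * t ^ p * (s - t ^ p)]; positivity at the far
    end [x] is the only condition. *)
Lemma mean_1Dpow_bounds (c : R) : let s := x `^ p in 0 < 1 + c * s ->
  let M := x / \int[lebesgue_measure]_(t in `[0, x]) (1 + c * t `^ p)^-1 in
  4 * (1 + c * s) * (1 + c * s / (p + 1)) / (2 + c * s) ^+ 2 <= M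
  /\ M <= 1 + c * s / (p + 1).
Proof.
move=> s cs0; set J := Rintegral _ _ _ => M; rewrite {}/M.
have q0 : 0 < p + 1 by rewrite addr_gt0.
have cp := within_continuous_powR.
have cf : {within `[0, x], continuous (fun t => 1 + c * t `^ p)}%classic.
  move=> t; apply: cvgD; first exact: cvg_cst.
  by apply: cvgM; [exact: cvg_cst|exact: cp].
set m := 1 + c * s / (p + 1).
have m0 : 0 < m.
  have -> : m = (p + (1 + c * s)) / (p + 1).
    by rewrite /m; field; rewrite gt_eqF.
  by rewrite divr_gt0 // addr_gt0.
have IE : \int[lebesgue_measure]_(t in `[0, x]) (1 + c * t `^ p) = x * m.
  under eq_Rintegral do rewrite -[c * _]opprK -mulNr.
  rewrite Rintegral_affine ?ltW//.
  by rewrite Rintegral_powR /m /s; field; rewrite gt_eqF.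
have I0 : 0 < x * m by rewrite mulr_gt0.
have fuv t : 0 <= t <= x ->
    0 <= (1 + c * t `^ p - 1) * (1 + c * s - (1 + c * t `^ p)).
  move=> /andP[t0 tx].
  have -> : (1 + c * t `^ p - 1) * (1 + c * s - (1 + c * t `^ p)) =
    c ^+ 2 * (t `^ p * (s - t `^ p)) by ring.
  rewrite mulr_ge0 ?sqr_ge0// mulr_ge0 ?powR_ge0// subr_ge0.
  by apply: ge0_ler_powR; rewrite ?nnegrE // ltW.
have := @le_Rintegral_mul_inv R 0 x 1 (1 + c * s) _ x0 ltr01 cs0 cf fuv.
have := @Rintegral_mul_inv_le R 0 x 1 (1 + c * s) _ x0 ltr01 cs0 cf fuv.
rewrite IE -/J subr0 => H1 H2.
have J0 : 0 < J.
  by rewrite -(pmulr_rgt0 _ I0); apply: lt_le_trans H2; rewrite exprn_gt0.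
split.
  rewrite ler_pdivlMr // mulrAC ler_pdivrMr ?exprn_gt0 //; last first.
    by rewrite -[2]/(1 + 1) -addrA addr_gt0.
  rewrite -(ler_pM2l x0).
  lra.
by rewrite ler_pdivrMr // -(ler_pM2l x0) mulrA -expr2.
Qed.

End powR_itv.

Theorem theorem2p13 (R : realType) (p a b : R)
    (hp : 2 <= p) (hb : 0 < b) (hab : b < a) :
  let x := (a - b) / (a + b) in
  let A := (a + b) / 2 in
  (4 * (1 + x `^ p) * (1 + x `^ p / (p + 1)) / (x `^ p + 2) ^+ 2
     <= T_p p a b / A
   /\ T_p p a b / A <= 1 + x `^ p / (1 + p))
  /\
  (4 * (1 - x `^ p) * (1 - x `^ p / (1 + p)) / (2 - x `^ p) ^+ 2
     <= L_p p a b / A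
   /\ L_p p a b / A <= 1 - x `^ p / (1 + p)).
Proof.
move=> x A.
have p0 : 0 < p by exact: lt_le_trans hp.
have ab0 : 0 < a + b by rewrite addr_gt0// (lt_trans hb).
have x0 : 0 < x by rewrite divr_gt0 ?subr_gt0.
have x1 : x < 1 by rewrite ltr_pdivrMr//; lra.
have s0 : 0 <= x `^ p := powR_ge0 _ _.
have s1 : x `^ p < 1.
  by have := @gt0_ltr_powR R p p0 x 1; rewrite !nnegrE powR1 ltW// ler01; apply.
have meanE J : (a - b) / (2 * J) / A = x / J.
  rewrite /A /x !invfM invrK; move: (J^-1) => K; field.
  by rewrite gt_eqF.
rewrite /T_p /L_p !meanE -/x /arctan_p /arctanh_p (addrC 1 p).
split.
  have /= := @mean_1Dpow_bounds R p x p0 x0 1.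
  rewrite !mul1r (addrC 2).
  under eq_Rintegral do rewrite mul1r.
  by apply; rewrite ltr_wpDr.
have /= := @mean_1Dpow_bounds R p x p0 x0 (-1).
rewrite !mulN1r mulNr.
under eq_Rintegral do rewrite mulN1r.
by apply; rewrite subr_gt0.
Qed.
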